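(* The following two statements are equivalent: (i) (No-arbitrage) For every $y\in\mathbb{R}^m$: if $\langle y,g(\omega)\rangle-\pi(y)\ge 0$ for all $\omega\in\Omega$, then $\langle y,g(\omega)\rangle-\pi(y)=0$ for all $\omega\in\Omega$. (ii) For every $\nu\in\mathcal{P}(\Omega)$ there exists $\mu\in\mathcal{Q}$ such that $\nu\ll\mu$.
   Context: $\Omega$ is a Polish space with its Borel $\sigma$-algebra, and $\mathcal{P}(\Omega)$ is the set of Borel probability measures on $\Omega$. Let $m\in\mathbb{N}$, let $g_1,\dots,g_m:\Omega\to\mathbb{R}$ be Borel measurable, and let $g=(g_1,\dots,g_m)^{\mathsf T}:\Omega\to\mathbb{R}^m$. Let $\underline{\pi}_j,\overline{\pi}_j\in\mathbb{R}$ with $\underline{\pi}_j\le\overline{\pi}_j$ for $j=1,\dots,m$ (bid and ask prices). For $y=(y_1,\dots,y_m)^{\mathsf T}\in\mathbb{R}^m$ set $$\pi(y):=\sum_{j=1}^m\big(y_j^+\overline{\pi}_j-y_j^-\underline{\pi}_j\big),\qquad y_j^+:=\max\{y_j,0\},\quad y_j^-:=\max\{-y_j,0\},$$ and $\langle y,g\rangle:=\sum_{j=1}^m y_jg_j:\Omega\to\mathbb{R}$. Define $$\mathcal{Q}:=\Big\{\mu\in\mathcal{P}(\Omega):\ \underline{\pi}_j\le\int_\Omega g_j\,\mathrm{d}\mu\le\overline{\pi}_j\ \text{ for } j=1,\dots,m\Big\},$$ where membership in $\mathcal{Q}$ includes that each $g_j$ is $\mu$-integrable. $\nu\ll\mu$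 denotes absolute continuity. *)

(* Defs.v *)
From HB Require Import structures.
From mathcomp Require Import all_boot all_order all_algebra.
From mathcomp Require Import all_classical all_reals all_analysis.

Set Implicit Arguments.
Unset Strict Implicit.
Unset Printing Implicit Defensive.

Import Order.TTheory GRing.Theory Num.Theory.
Import numFieldNormedType.Exports.

Local Open Scope classical_set_scope.
Local Open Scope ring_scope.

Definition separable (T : topologicalType) : Prop :=
  exists2 D : set T, countable D & dense D.

Definition homeomorphism (S T : topologicalType) (f : S -> T) : Prop :=
  exists g : T -> S, [/\ cancel f g, cancel g f, continuous f & continuous g].

(* The library joins completeness only with pseudometrics, not with
   [metricType], and does so for pointed types; hence [cauchy_cvg] is restated
   here for the metric space [M]. *)
Definition completely_metrizable (R : realType) (T : topologicalType) : Prop :=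
  exists (M : metricType R) (f : T -> M), homeomorphism f /\
    (forall F : set_system M, ProperFilter F -> cauchy F -> exists x : M, F --> x).

Definition polish (R : realType) (T : topologicalType) : Prop :=
  separable T /\ completely_metrizable R T.

(* The points of [T], equipped with the sigma-algebra generated by the open
   sets of [T]. *)
Notation borel T := (g_sigma_algebraType (@open T)).

Section market.
Context {R : realType} {m : nat}.

Definition pos_part (x : R) : R := Num.max x 0.
Definition neg_part (x : R) : R := Num.max (- x) 0.

Definition price (bid ask : 'rV[R]_m) (y : 'rV[R]_m) : R :=
  \sum_(j < m) (pos_part (y 0 j) * ask 0 j - neg_part (y 0 j) * bid 0 j).

Definition payoff {Omega : Type} (g : 'I_m -> Omega -> R) (y : 'rV[R]_m)
    (omega : Omega) : R :=
  \sum_(j < m) y 0 j * g j omega.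

Definition no_arbitrage {Omega : Type} (g : 'I_m -> Omega -> R)
    (bid ask : 'rV[R]_m) : Prop :=
  forall y : 'rV[R]_m,
    (forall omega, 0 <= payoff g y omega - price bid ask y) ->
    (forall omega, payoff g y omega - price bid ask y = 0).

Definition calibrated {d : measure_display} {Omega : measurableType d}
    (g : 'I_m -> Omega -> R) (bid ask : 'rV[R]_m) : set (probability Omega R) :=
  [set mu | forall j : 'I_m,
    mu.-integrable [set: Omega] (fun omega => (g j omega)%:E) /\
    ((bid 0 j)%:E <= \int[mu]_omega (g j omega)%:E <= (ask 0 j)%:E)%E].

End market.

(* Main.v *)
Require Import Defs.
From HB Require Import structures.
From mathcomp Require Import all_boot all_order all_algebra.
From mathcomp Require Import all_classical all_reals all_analysis.
From mathcomp Require Import measurable_realfun.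
From mathcomp Require Import ring lra.

(** Why the theorem is true.

    From (ii) to (i): suppose that [payoff g y - price y] is nonnegative and
    let [mu] be a calibrated measure dominating the Dirac mass at [w].  Since
    the moments of [mu] lie in the box of quotes, on which [dot y] is at most
    [price y], this nonnegative function has a nonpositive [mu]-integral.  It
    therefore vanishes [mu]-almost everywhere, hence almost everywhere for the
    Dirac mass, that is, at [w].

    From (i) to (ii): fix [nu], and let K be the set [attainable nu] of all
    moment vectors (int g_1 dmu, ..., int g_m dmu), [mu] ranging over the
    probabilities that dominate [nu] and integrate every g_j.  The claim is
    that K meets the box of quotes.  The set K is convex because mixtures of
    measures mix their moments, and nonempty because [nu] is dominated by a
    measure that charges large values of |g_1| + ... + |g_m| so little that
    all the g_j become integrable ([integrable_dominating]).  Replacing part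
    of an attaining measure by a Dirac mass at [w] stays in K, so an inequality
    [price y <= dot y k] valid on all of K is valid at every point of the
    market ([superreplicates_pointwise]): absence of arbitrage on the market
    gives absence of arbitrage on K.

    What remains is the finite-dimensional statement [box_meets_convex]: a
    nonempty convex set K without arbitrage meets the box.  The set K need
    not be closed, so the two can only be separated weakly, and that is not
    enough: [dot y] could be constant on K, which is no arbitrage.  The
    difference K - box is separated from 0 properly ([proper_separation0]).
    Then either K realizes the strict inequality, which is an arbitrage, or the
    box does, and then only a proper face of the box can still touch K.  In the
    second case the face has fewer nondegenerate sides and inherits the absence
    of arbitrage: an arbitrage y' against the face becomes one against the box
    after adding a large multiple of y ([price_face]).  Induction on the number
    of nondegenerate sides concludes.

    Proper separation is itself proved by eliminating coordinates one at a
    time, the only analytic ingredient being a supremum of slopes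
    ([sign_crossing_slope]). *)

Import Order.TTheory GRing.Theory Num.Theory.
Import numFieldNormedType.Exports.

Local Open Scope classical_set_scope.
Local Open Scope ring_scope.

(** * Proper separation of a convex set from the origin *)

(** Coefficients as plain real numbers are easier to compute with than
    elements of the unit interval type. *)
Lemma convex_setP (R : numDomainType) (M : lmodType R) (K : set M) :
  convex_set K <->
  (forall x y t, 0 < t -> t < 1 -> K x -> K y -> K (t *: x + (1 - t) *: y)).
Proof.
rewrite convex_setW; split => [cK x y t t0 t1 Kx Ky|cK x y xK yK k k0 k1].
  have := cK x y (mem_set Kx) (mem_set Ky) (Itv01 (ltW t0) (ltW t1)) t0 t1.
  by rewrite inE.
rewrite inE; apply: cK => //; exact: set_mem.
Qed.

Section dot.
Context {R : realType} {m : nat}.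
Implicit Types (x y k bid ask : 'rV[R]_m) (K : set 'rV[R]_m).

Definition dot y k : R := \sum_(j < m) y 0 j * k 0 j.

Lemma dotDl y z k : dot (y + z) k = dot y k + dot z k.
Proof.
by rewrite /dot -big_split; apply: eq_bigr => j _; rewrite mxE mulrDl.
Qed.

Lemma dotZl (a : R) y k : dot (a *: y) k = a * dot y k.
Proof.
by rewrite /dot mulr_sumr; apply: eq_bigr => j _; rewrite mxE mulrA.
Qed.

Lemma dotC y k : dot y k = dot k y.
Proof. by apply: eq_bigr => j _; rewrite mulrC. Qed.

Lemma dotDr y k l : dot y (k + l) = dot y k + dot y l.
Proof. by rewrite dotC dotDl !(dotC y). Qed.

Lemma dotZr (a : R) y k : dot y (a *: k) = a * dot y k.
Proof. by rewrite dotC dotZl dotC. Qed.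

Lemma dotBr y k l : dot y (k - l) = dot y k - dot y l.
Proof. by rewrite -scaleN1r dotDr dotZr mulN1r. Qed.

Lemma dot_delta (a : R) j k : dot (a *: delta_mx 0 j) k = a * k 0 j.
Proof.
rewrite dotZl /dot (bigD1 j)//= big1 => [|i ij]; rewrite mxE !eqxx/=.
  by rewrite mul1r addr0.
by rewrite (negPf ij) mul0r.
Qed.

(** Lagrange multiplier for the constraint that coordinate j vanishes.  For k
    on the negative and l on the positive side of the hyperplane, the segment
    [k, l] crosses it at a point of K where [dot y] is nonnegative; this says
    that the lower bound on the multiplier coming from l is at most the upper
    bound coming from k.  Any number between the two families works, such as
    the supremum of the lower bounds. *)
Lemma sign_crossing_slope K y j k1 k2 : convex_set K ->
  (forall k, K k -> k 0 j = 0 -> 0 <= dot y k) ->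
  K k1 -> k1 0 j < 0 -> K k2 -> 0 < k2 0 j ->
  exists a, forall k, K k -> 0 <= dot y k + a * k 0 j.
Proof.
move=> /convex_setP cK y0 Kk1 k1j Kk2 k2j.
have cross k l : K k -> K l -> k 0 j < 0 -> 0 < l 0 j ->
    - dot y l / l 0 j <= dot y k / - k 0 j.
  move=> Kk Kl kj lj; have klj : 0 < l 0 j - k 0 j by lra.
  have klj0 : l 0 j - k 0 j != 0 by rewrite gt_eqF.
  (* the weight of k at which the segment from k to l crosses the hyperplane *)
  pose t := l 0 j / (l 0 j - k 0 j).
  have t0 : 0 < t by rewrite divr_gt0.
  have t1 : t < 1 by rewrite ltr_pdivrMr// mul1r; lra.
  have := y0 _ (cK _ _ _ t0 t1 Kk Kl).
  rewrite !mxE dotDr !dotZr => h.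
  have /h{}h : t * k 0 j + (1 - t) * l 0 j = 0 by rewrite /t; field.
  rewrite ler_pdivlMr ?oppr_gt0// mulrAC ler_pdivrMr//.
  have : 0 <= (t * dot y k + (1 - t) * dot y l) * (l 0 j - k 0 j).
    by rewrite mulr_ge0// ltW.
  rewrite (_ : _ * _ = l 0 j * dot y k - k 0 j * dot y l); first by lra.
  by rewrite /t; field.
pose A := [set - dot y l / l 0 j | l in [set l | K l /\ 0 < l 0 j]].
have A0 : A !=set0 by exists (- dot y k2 / k2 0 j), k2.
have ubA k : K k -> k 0 j < 0 -> ubound A (dot y k / - k 0 j).
  by move=> Kk kj _ [l [Kl lj] <-]; exact: cross.
exists (sup A) => k Kk; have [kj|kj|kj] := ltgtP (k 0 j) 0.
- have := ge_sup A0 (ubA _ Kk kj).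
  by rewrite ler_pdivlMr ?oppr_gt0//; lra.
- have : - dot y k / k 0 j <= sup A.
    by apply: ub_le_sup; [exists (dot y k1 / - k1 0 j); exact: ubA|exists k].
  by rewrite ler_pdivrMr//; lra.
- by rewrite kj mulr0 addr0 y0.
Qed.

(** Induction on the list of coordinates that have to vanish.  If coordinate j
    keeps one sign on K and is not identically zero there, then up to sign it
    is itself a proper separator.  If it takes both signs, the slice of K where
    it vanishes is nonempty and convex, and a proper separator of the slice
    extends to K with the multiplier of [sign_crossing_slope]; strictness
    survives because the added term is zero on the slice. *)
Lemma proper_separation_coordinates (s : seq 'I_m) K :
  convex_set K -> K !=set0 ->
  (exists2 k, K k & {in s, forall j, k 0 j = 0}) \/
  (exists2 y, forall k, K k -> 0 <= dot y k & exists2 k, K k & 0 < dot y k).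
Proof.
elim: s K => [|j s ih] K cK [k0 Kk0]; first by left; exists k0.
have dotN k : dot (-1 *: delta_mx 0 j) k = - k 0 j by rewrite dot_delta mulN1r.
have dotP k : dot (1 *: delta_mx 0 j) k = k 0 j by rewrite dot_delta mul1r.
have [[k1 Kk1 k1j]|noneg] := pselect (exists2 k, K k & k 0 j < 0); last first.
  have [[k2 Kk2 k2j]|nopos] := pselect (exists2 k, K k & 0 < k 0 j).
    right; exists (1 *: delta_mx 0 j); last by exists k2; rewrite ?dotP.
    move=> k Kk; rewrite dotP leNgt.
    by apply/negP => kj; apply: noneg; exists k.
  have Kj k : K k -> k 0 j = 0.
    by move=> Kk; have [kj|kj|//] := ltgtP (k 0 j) 0;
      [case: noneg|case: nopos]; exists k.
  have [|[k Kk ks]|] := ih _ cK; [by exists k0| |by right].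
  by left; exists k => // i; rewrite inE => /predU1P[->|/ks//]; exact: Kj.
have [[k2 Kk2 k2j]|nopos] := pselect (exists2 k, K k & 0 < k 0 j); last first.
  right; exists (-1 *: delta_mx 0 j).
    move=> k Kk; rewrite dotN oppr_ge0 leNgt.
    by apply/negP => kj; apply: nopos; exists k.
  by exists k1; rewrite ?dotN ?oppr_gt0.
have k12 : 0 < k2 0 j - k1 0 j by lra.
have /convex_setP cK' := cK.
case: (ih (K `&` [set k | k 0 j = 0])).
- apply/convex_setP => x y t t0 t1 [Kx xj] [Ky yj]; split; first exact: cK'.
  by rewrite /= !mxE xj yj !mulr0 addr0.
- pose t := k2 0 j / (k2 0 j - k1 0 j).
  exists (t *: k1 + (1 - t) *: k2); split.
    by apply: cK' => //; rewrite /t ?divr_gt0// ltr_pdivrMr//; lra.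
  by rewrite /= !mxE /t; field; rewrite gt_eqF.
- move=> [k [Kk kj] ks]; left; exists k => // i.
  by rewrite inE => /predU1P[->|/ks].
move=> [y y0 [k [Kk kj] yk]]; right.
have [|a ya] := @sign_crossing_slope K y j k1 k2 cK _ Kk1 k1j Kk2 k2j.
  by move=> l Kl lj; exact: y0.
exists (y + a *: delta_mx 0 j) => [l Kl|]; first by rewrite dotDl dot_delta ya.
by exists k; rewrite // dotDl dot_delta kj mulr0 addr0.
Qed.

Lemma proper_separation0 K : convex_set K -> K !=set0 -> ~ K 0 ->
  exists2 y, forall k, K k -> 0 <= dot y k & exists2 k, K k & 0 < dot y k.
Proof.
move=> cK K0 nK0.
have [[k Kk ks]|//] := proper_separation_coordinates (enum 'I_m) _ cK K0.
case: nK0; suff <- : k = 0 by [].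
by apply/rowP => j; rewrite mxE ks ?mem_enum.
Qed.

(** * Convex sets without arbitrage meet the box of quotes *)

Definition superreplicates K (bid ask y : 'rV[R]_m) :=
  forall k, K k -> price bid ask y <= dot y k.

Definition replicates K (bid ask y : 'rV[R]_m) :=
  forall k, K k -> dot y k = price bid ask y.

(** Among the points of the box, this vertex maximizes [dot y]. *)
Definition effective_quote (bid ask y : 'rV[R]_m) : 'rV[R]_m :=
  \row_j (if 0 <= y 0 j then ask 0 j else bid 0 j).

Lemma priceE bid ask y : price bid ask y = dot y (effective_quote bid ask y).
Proof.
apply: eq_bigr => j _; rewrite mxE /pos_part /neg_part.
case: (leP 0 (y 0 j)) => yj.
  have -> : Num.max (- y 0 j) 0 = 0 by apply/max_idPr; rewrite oppr_le0.
  by rewrite mul0r subr0.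
have -> : Num.max (- y 0 j) 0 = - y 0 j by apply/max_idPl; rewrite oppr_ge0 ltW.
by rewrite mul0r sub0r mulNr opprK.
Qed.

(** Applied to [bid] and to [ask] with q the effective quotes in direction y,
    this gives the two quotes of the face of the box on which [dot y] is
    maximal. *)
Definition face_bound (y c q : 'rV[R]_m) : 'rV[R]_m :=
  \row_j (if y 0 j == 0 then c 0 j else q 0 j).

(** The price is the support function of the box, and its directional
    derivative at y is the support function of the face exposed by y.  As the
    box is a polytope, the first-order expansion is exact once y is scaled by a
    large enough factor. *)
Lemma price_face bid ask y y' : let q := effective_quote bid ask y in
  exists t, price bid ask (y' + t *: y) =
    price (face_bound y bid q) (face_bound y ask q) y' + t * price bid ask y.
Proof.
move=> q; pose t := \sum_j `|y' 0 j / y 0 j|; exists t.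
(* t is so large that t * y dominates y' in every coordinate where y does
   not vanish; there y' + t * y vanishes or has the sign of y, and in the latter
   case it is traded at the same quote *)
rewrite !priceE /dot mulr_sumr -big_split; apply: eq_bigr => j _ /=.
rewrite !mxE; have [->|yj] := eqVneq (y 0 j) 0.
  by rewrite !(mul0r, mulr0, addr0).
rewrite if_same mulrA -mulrDl.
have tj : `|y' 0 j / y 0 j| <= t.
  by rewrite /t (bigD1 j)//= lerDl sumr_ge0.
have -> : y' 0 j + t * y 0 j = (y' 0 j / y 0 j + t) * y 0 j by field.
have : 0 <= y' 0 j / y 0 j + t.
  by move: tj; rewrite ler_norml => /andP[]; lra.
rewrite le_eqVlt => /predU1P[<-|t0]; first by rewrite !mul0r.
by rewrite pmulr_rge0.
Qed.

(** Induction on the number of nondegenerate sides of the box.  If K misses the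
    box, a proper separator y of their difference superreplicates, so absence
    of arbitrage makes [dot y] constant on K; hence the strict inequality of
    proper separation is attained inside the box, and the face exposed by y is
    strictly smaller. *)
Lemma box_meets_convex K bid ask : (forall j, bid 0 j <= ask 0 j) ->
  convex_set K -> K !=set0 ->
  (forall y, superreplicates K bid ask y -> replicates K bid ask y) ->
  exists2 k, K k & forall j, bid 0 j <= k 0 j <= ask 0 j.
Proof.
have [n] := ubnP #|[pred j | bid 0 j < ask 0 j]|.
elim: n bid ask => // n ih bid ask; rewrite ltnS => cardn ba cK K0 naK.
have /convex_setP cK' := cK.
pose B := [set b : 'rV[R]_m | forall j, bid 0 j <= b 0 j <= ask 0 j].
have Bbid : B bid by move=> j; rewrite lexx ba.
have [//|disj] := pselect (exists2 k, K k & B k).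
have [|||y y0 [_ [k Kk [b Bb <-]] ykb]] :=
    @proper_separation0 [set k - b | k in K & b in B].
- apply/convex_setP => _ _ t t0 t1 [k Kk [b Bb <-]] [l Kl [c Bc <-]].
  exists (t *: k + (1 - t) *: l); first exact: cK'.
  exists (t *: b + (1 - t) *: c).
    move=> j; rewrite !mxE; have /andP[? ?] := Bb j; have /andP[? ?] := Bc j.
    by apply/andP; split; nra.
  by rewrite !scalerBr opprD addrACA.
- by case: K0 => k Kk; exists (k - bid), k => //; exists bid.
- move=> [k Kk [b Bb]] /eqP; rewrite subr_eq0 => /eqP kb.
  by apply: disj; exists k; rewrite // kb.
set q := effective_quote bid ask y.
have Bq : B q by move=> j; rewrite mxE; case: ifP => _; rewrite lexx ba.
have sy : superreplicates K bid ask y.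
  move=> l Kl; rewrite priceE -subr_ge0 -dotBr.
  by apply: y0; exists l => //; exists q.
have ry := naK _ sy.
(* if y only charged degenerate sides, dot y would be constant on the box
   as well, contradicting the strict inequality ykb *)
have [j yj baj] : exists2 j, y 0 j != 0 & bid 0 j < ask 0 j.
  apply: contrapT => nj; move: ykb; rewrite dotBr ry// priceE -/q -dotBr.
  rewrite /dot big1 ?ltxx// => j _; have [->|yj] := eqVneq (y 0 j) 0.
    by rewrite mul0r.
  have baj : ask 0 j <= bid 0 j.
    by rewrite leNgt; apply/negP => baj; apply: nj; exists j.
  have := Bb j; have := Bq j; have := ba j.
  rewrite !mxE => ? /andP[? ?] /andP[? ?].
  by apply/eqP; rewrite mulf_eq0; apply/orP; right; apply/eqP; lra.
have [||//|//|y' sy' l Kl|k0 Kk0 face] :=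
    ih (face_bound y bid q) (face_bound y ask q).
- apply: leq_trans cardn; apply: proper_card; apply/fintype.properP; split.
    apply/fintype.subsetP => i; rewrite !inE !mxE; case: ifP => // _.
    by rewrite ltxx.
  by exists j; rewrite !inE // !mxE (negPf yj) ltxx.
- by move=> i; rewrite !mxE; case: ifP.
- have [t priceD] := price_face bid ask y y'.
  (* an arbitrage y' against the face turns into y' + t *: y against the box *)
  have : superreplicates K bid ask (y' + t *: y).
    by move=> h Kh; rewrite priceD dotDl dotZl (ry _ Kh) lerD2r sy'.
  move=> /naK/(_ _ Kl); rewrite priceD dotDl dotZl (ry _ Kl).
  exact: addIr.
- exists k0 => // i; have := face i; rewrite !mxE; case: ifP => // _.
  move=> /andP[h1 h2]; have /andP[h3 h4] := Bq i.
  move: h1 h2 h3 h4; rewrite !mxE.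
  by case: ifP => _ *; apply/andP; split; lra.
Qed.

End dot.

(** * Scaled, mixed and dominating measures *)

Section measures.
Context {R : realType} {d : measure_display} {T : measurableType d}.
Implicit Types (mu : {measure set T -> \bar R}) (P : probability T R).
Local Open Scope ereal_scope.

(** Normalization is the identity on a measure of mass 1, and its values carry
    the structure of a probability. *)
Lemma probability_of_mass1 mu P : mu setT = 1 ->
  exists Q : probability T R, (Q : set T -> \bar R) = mu.
Proof.
move=> mu1; exists (mnormalize mu P); apply/funext => A.
by rewrite /= /mnormalize mu1 eqe oner_eq0/= invr1 mule1.
Qed.

Lemma integrable_mscale mu (k : {nonneg R}) (f : T -> \bar R) :
  mu.-integrable setT f -> (mscale k mu).-integrable setT f.
Proof.
move=> /integrableP[mf foo]; apply/integrableP; split => //.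
rewrite ge0_integral_mscale//; last exact: measurableT_comp.
by rewrite lte_mul_pinfty// lee_fin.
Qed.

Lemma integral_mscale mu (k : {nonneg R}) (f : T -> \bar R) :
  mu.-integrable setT f ->
  \int[mscale k mu]_x f x = k%:num%:E * \int[mu]_x f x.
Proof.
move=> fi; have mf := measurable_int mu fi.
rewrite [LHS]integralE [X in _ * X]integralE muleBr//; last first.
  rewrite fin_num_adde_defl// fin_numN.
  exact: integrable_neg_fin_num.
rewrite !ge0_integral_mscale//.
- exact: measurable_funeneg.
- exact: measurable_funepos.
Qed.

Lemma integrable_measure_add mu1 mu2 (f : T -> \bar R) :
  mu1.-integrable setT f -> mu2.-integrable setT f ->
  (measure_add mu1 mu2).-integrable setT f.
Proof.
move=> /integrableP[mf foo1] /integrableP[_ foo2].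
apply/integrableP; split => //.
rewrite ge0_integral_measure_add//; last exact: measurableT_comp.
exact: lte_add_pinfty.
Qed.

Lemma exists_mixture P0 P1 (t : R) : (0 <= t)%R -> (t <= 1)%R ->
  exists P : probability T R,
    (forall A, P A = t%:E * P0 A + (1 - t)%:E * P1 A) /\
    (forall f : T -> R, P0.-integrable setT (EFin \o f) ->
      P1.-integrable setT (EFin \o f) ->
      P.-integrable setT (EFin \o f) /\
      \int[P]_x (f x)%:E =
        t%:E * \int[P0]_x (f x)%:E + (1 - t)%:E * \int[P1]_x (f x)%:E).
Proof.
move=> t0 t1; have t1' : (0 <= 1 - t)%R by rewrite subr_ge0.
pose mu : {measure set T -> \bar R} :=
  measure_add (mscale (NngNum t0) P0) (mscale (NngNum t1') P1).
have muE A : mu A = t%:E * P0 A + (1 - t)%:E * P1 A.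
  by rewrite [LHS]measure_addE.
have [|P PE] := probability_of_mass1 mu P0.
  by rewrite muE !probability_setT !mule1 -EFinD addrC subrK.
exists P; rewrite PE; split => // f f0 f1.
have ? := integrable_mscale _ (NngNum t0) _ f0.
have ? := integrable_mscale _ (NngNum t1') _ f1.
split; first exact: integrable_measure_add.
have mf := measurable_int P0 f0.
by rewrite integral_measure_add// !integral_mscale.
Qed.

Lemma dirac_integrable (a : T) (f : T -> R) : measurable_fun setT f ->
  (dirac a : {measure set T -> \bar R}).-integrable setT (EFin \o f).
Proof.
move=> mf; apply/integrableP; split; first exact/measurable_EFinP.
rewrite integral_dirac//; last first.
  by apply: measurableT_comp => //; exact/measurable_EFinP.
by rewrite diracT mul1e ltry.
Qed.

(** Restrict P to the sets where [G <= n + 1] and sum these restrictions with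
    weights 2^-(n+1) / (n+1).  The n-th term contributes at most 2^-(n+1) to
    the integral of G.  All weights are positive and the sets exhaust the
    space, so null sets of the sum are null for P. *)
Lemma integrable_dominating P (G : T -> R) : measurable_fun setT G ->
  (forall x, 0 <= G x)%R ->
  exists2 Q : probability T R, P `<< Q & Q.-integrable setT (EFin \o G).
Proof.
move=> mG G0.
pose A n := [set x | G x <= n.+1%:R]%R.
have mA n : measurable (A n).
  rewrite (_ : A n = G @^-1` `]-oo, n.+1%:R]%classic).
    by rewrite -[_ @^-1` _]setTI; exact: mG.
  by apply/seteqP; split => x /=; rewrite in_itv.
have w0 n : (0 <= 1 / (2 ^ n.+1)%:R / n.+1%:R :> R)%R by rewrite divr_ge0.
pose m_ n : {measure set T -> \bar R} :=
  mscale (NngNum (w0 n)) (mrestr P (mA n)).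
pose mu : {measure set T -> \bar R} := mseries m_ 0.
have geo : \sum_(n <oo) (1 / (2 ^ n.+1)%:R : R)%:E < +oo.
  by apply: le_lt_trans (epsilon_trick0 xpredT ler01) _; rewrite ltry.
have restr_le1 n : mrestr P (mA n) setT <= 1.
  exact: probability_le1 (measurableI _ _ measurableT (mA n)).
have muG : \int[mu]_x (G x)%:E < +oo.
  have mGE : measurable_fun setT (EFin \o G) by exact/measurable_EFinP.
  rewrite ge0_integral_measure_series//; last by move=> x _; rewrite lee_fin.
  apply: le_lt_trans geo; apply: lee_nneseries => [n _ _|n _].
    by apply: integral_ge0 => x _; rewrite lee_fin.
  rewrite ge0_integral_mscale//; last by move=> x _; rewrite lee_fin.
  have bound : \int[mrestr P (mA n)]_x (G x)%:E <= n.+1%:R%:E.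
    under eq_integral do rewrite -[G _]ger0_norm//.
    apply: (@le_trans _ _ (n.+1%:R%:E * mrestr P (mA n) setT)).
      apply: (integral_le_bound (f := EFin \o G)) => //.
      exists (~` A n); split; first exact: measurableC.
        by rewrite /= /mrestr setICl measure0.
      by move=> x /=; apply: contra_not => Ax _; rewrite lee_fin ger0_norm.
    by rewrite -[leRHS]mule1 lee_pmul2l// lte_fin ltr0n.
  rewrite [leLHS]/= (_ : _%:E = (1 / (2 ^ n.+1)%:R)%:E * (n.+1%:R^-1)%:E)%E//.
  rewrite -muleA -[leRHS]mule1 lee_wpmul2l ?lee_fin//.
  rewrite muleC lee_pdivrMr// mul1e.
  exact: bound.
have dom B : measurable B -> mu B = 0 -> P B = 0.
  move=> mB muB0.
  have PBA n : P (B `&` A n) = 0.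
    have : m_ n B <= mu B.
      by rewrite [leRHS](nneseriesD1 (n := n))// leeDl// nneseries_ge0.
    rewrite muB0 measure_le0 => /eqP/eqP.
    rewrite /mscale mule_eq0 => /orP[|/eqP//].
    by rewrite eqe gt_eqF// divr_gt0// divr_gt0// ltr0n expn_gt0.
  rewrite (_ : B = \bigcup_n (B `&` A n)).
    apply/negligibleP.
      by apply: bigcup_measurable => n _; exact: measurableI.
    apply: negligible_bigcup => n; apply/negligibleP; first exact: measurableI.
    exact: PBA.
  rewrite -setI_bigcupr setIidl// => x _.
  exists (Num.bound (G x)) => //; rewrite /A/=.
  by rewrite (le_trans (ltW (archi_boundP (G0 x))))// ler_nat.
have mufin : mu setT < +oo.
  apply: le_lt_trans geo; apply: lee_nneseries => [n _ _//|n _].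
  rewrite -[leRHS]mule1 lee_pmul//= ?lee_fin//.
  by rewrite ler_pdivrMr// ler_peMr// ler1n.
have mu0 : 0 < mu setT.
  rewrite lt0e measure_ge0 andbT; apply/eqP => /(dom _ measurableT).
  by rewrite probability_setT => /eqP; rewrite onee_eq0.
have c0 : (0 <= (fine (mu setT))^-1)%R by rewrite invr_ge0 fine_ge0.
have [|Q QE] := probability_of_mass1 (mscale (NngNum c0) mu) P.
  rewrite -[LHS]/((fine (mu setT))^-1%:E * mu setT).
  rewrite -[X in _ * X]fineK ?ge0_fin_numE//.
  by rewrite -EFinM mulVf// fine_eq0 ?gt_eqF ?ge0_fin_numE.
exists Q.
  apply/null_content_dominatesP => B mB QB0.
  have : (fine (mu setT))^-1%:E * mu B == 0.
    by rewrite -[X in X == _]/(mscale (NngNum c0) mu B) -QE; exact/eqP.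
  rewrite mule_eq0 => /orP[|/eqP]; last exact: dom.
  by rewrite eqe invr_eq0 fine_eq0 ?ge0_fin_numE// gt_eqF.
rewrite QE; apply: integrable_mscale; apply/integrableP; split.
  exact/measurable_EFinP.
by under eq_integral do rewrite /= ger0_norm//.
Qed.

End measures.

(** * The two implications over a measurable space *)

Section ftap.
Context {R : realType} {d : measure_display} {T : measurableType d} {m : nat}.
Variable g : 'I_m -> T -> R.
Hypothesis mg : forall j, measurable_fun [set: T] (g j).
Implicit Types (mu nu P : probability T R) (bid ask y k : 'rV[R]_m).

Definition has_moments mu k := forall j,
  mu.-integrable setT (EFin \o g j) /\
  (\int[mu]_w (g j w)%:E = (k 0 j)%:E)%E.

Definition attainable nu : set 'rV[R]_m :=
  [set k | exists2 mu : probability T R, nu `<< mu & has_moments mu k].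

Lemma integral_payoff mu k y : has_moments mu k ->
  mu.-integrable setT (EFin \o payoff g y) /\
  (\int[mu]_w (payoff g y w)%:E = (dot y k)%:E)%E.
Proof.
move=> muk.
have payE w : (payoff g y w)%:E = (\sum_(j < m) (y 0 j)%:E * (g j w)%:E)%E.
  by rewrite /payoff -sumEFin; apply: eq_bigr => j _; rewrite EFinM.
have gi j : mu.-integrable setT (fun w => (y 0 j)%:E * (g j w)%:E)%E.
  by apply: integrableZl => //; exact: (muk j).1.
split.
  rewrite (_ : _ \o _ = fun w => \sum_(j < m) (y 0 j)%:E * (g j w)%:E)%E.
    exact: integrable_sum.
  exact/funext.
under eq_integral do rewrite payE.
rewrite integral_sum// /dot -sumEFin; apply: eq_bigr => j _.
by rewrite integralZl ?(muk j).2//; exact: (muk j).1.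
Qed.

Lemma has_moments_mix P0 P1 k0 k1 (t : R) : 0 <= t -> t <= 1 ->
  has_moments P0 k0 -> has_moments P1 k1 ->
  exists mu : probability T R,
    (forall A, mu A = t%:E * P0 A + (1 - t)%:E * P1 A)%E /\
    has_moments mu (t *: k0 + (1 - t) *: k1).
Proof.
move=> t0 t1 h0 h1; have [mu [muE mui]] := exists_mixture P0 P1 t t0 t1.
exists mu; split => // j; have [i0 e0] := h0 j; have [i1 e1] := h1 j.
have [i e] := mui _ i0 i1; split => //.
by rewrite e e0 e1 !mxE -!EFinM -EFinD.
Qed.

Lemma dominates_mix nu mu P0 P1 (t : R) : 0 < t -> t <= 1 ->
  (forall A, mu A = t%:E * P0 A + (1 - t)%:E * P1 A)%E ->
  nu `<< P0 -> nu `<< mu.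
Proof.
move=> t0 t1 muE /null_content_dominatesP nuP0.
apply/null_content_dominatesP => A mA muA0; apply: nuP0 => //.
move/eqP : muA0.
rewrite [_ A]muE padde_eq0 ?mule_ge0 ?lee_fin ?subr_ge0 ?(ltW t0)//.
by rewrite mule_eq0 eqe gt_eqF//= => /andP[/eqP].
Qed.

Lemma convex_attainable nu : convex_set (attainable nu).
Proof.
apply/convex_setP => k0 k1 t t0 t1 [P0 d0 h0] [P1 _ h1].
have [mu [muE muk]] := has_moments_mix _ _ _ _ t (ltW t0) (ltW t1) h0 h1.
by exists mu => //; exact: (dominates_mix _ _ _ _ t t0 (ltW t1) muE d0).
Qed.

Lemma attainable_nonempty nu : attainable nu !=set0.
Proof.
pose G w := \sum_(j < m) `|g j w|.
have mG : measurable_fun setT G.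
  by apply: measurable_sum => j; exact: measurableT_comp.
have [||Q nuQ GQ] := integrable_dominating nu G => //.
  by move=> w; apply: sumr_ge0.
have iQ j : Q.-integrable setT (EFin \o g j).
  apply: le_integrable GQ => //; first exact/measurable_EFinP.
  move=> w _ /=; rewrite lee_fin [leRHS]ger0_norm ?sumr_ge0//.
  by rewrite /G (bigD1 j)//= lerDl sumr_ge0.
exists (\row_j fine (\int[Q]_w (g j w)%:E)%E), Q => // j; split => //.
by rewrite mxE fineK//; exact: (integrable_fin_num measurableT (iQ j)).
Qed.

Lemma attainable_dirac nu k w (t : R) : 0 < t -> t <= 1 -> attainable nu k ->
  attainable nu (t *: k + (1 - t) *: \row_j g j w).
Proof.
move=> t0 t1 [P0 d0 h0].
have h1 : has_moments (dirac w : probability T R) (\row_j g j w).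
  move=> j; split; first exact: dirac_integrable.
  rewrite integral_dirac//; last exact/measurable_EFinP.
  by rewrite diracT mul1e mxE.
have [mu [muE muk]] := has_moments_mix _ _ _ _ t (ltW t0) t1 h0 h1.
by exists mu => //; exact: (dominates_mix _ _ _ _ t t0 t1 muE d0).
Qed.

Lemma payoff_dot y w : payoff g y w = dot y (\row_j g j w).
Proof. by apply: eq_bigr => j _; rewrite mxE. Qed.

(** Attainable vectors can be moved from a fixed k arbitrarily close to the
    payoffs at w by mixing with a Dirac mass.  The full Dirac mass is excluded,
    as it need not dominate nu, hence the limiting argument. *)
Lemma superreplicates_pointwise nu bid ask y w :
  superreplicates (attainable nu) bid ask y ->
  0 <= payoff g y w - price bid ask y.
Proof.
move=> sy; have [k Kk] := attainable_nonempty nu.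
set p := price bid ask y; set x := payoff g y w; set a := dot y k.
have mix t : 0 < t -> t <= 1 -> p <= t * a + (1 - t) * x.
  move=> t0 t1; have := sy _ (attainable_dirac _ _ w t t0 t1 Kk).
  by rewrite dotDr !dotZr -payoff_dot.
rewrite leNgt; apply/negP => xp.
have pa : p <= a by have := mix 1 ltr01 (lexx _); lra.
have ax : 0 < a - x by lra.
(* this weight moves only half of the way from x back up to p *)
pose t := (p - x) / (2 * (a - x)).
have t0 : 0 < t by rewrite divr_gt0 ?mulr_gt0//; lra.
have t1 : t <= 1 by rewrite ler_pdivrMr ?mulr_gt0// mul1r; lra.
have tax : t * (a - x) = (p - x) / 2 by rewrite /t; field; rewrite gt_eqF.
have := mix _ t0 t1; lra.
Qed.

Lemma dot_le_price bid ask y k : (forall j, bid 0 j <= k 0 j <= ask 0 j) ->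
  dot y k <= price bid ask y.
Proof.
move=> kbox; rewrite priceE; apply: ler_sum => j _; rewrite mxE.
have /andP[bk ka] := kbox j; case: (leP 0 (y 0 j)) => yj.
  by rewrite ler_wpM2l.
by rewrite ler_wnM2l// ltW.
Qed.

(** The calibrated measure dominating a Dirac mass at w transports an almost
    everywhere equality to the point w. *)
Lemma no_arbitrage_of_calibrated bid ask :
  (forall nu : probability T R,
    exists2 mu : probability T R, calibrated g bid ask mu & nu `<< mu) ->
  no_arbitrage g bid ask.
Proof.
move=> dom y ypos w.
pose h w := payoff g y w - price bid ask y.
have [mu cal dmu] := dom (dirac w : probability T R).
pose k : 'rV[R]_m := \row_j fine (\int[mu]_w (g j w)%:E)%E.
have ck j : (\int[mu]_w (g j w)%:E)%E = (k 0 j)%:E.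
  by rewrite mxE fineK//; exact: (integrable_fin_num measurableT (cal j).1).
have muk : has_moments mu k by move=> j; split; [exact: (cal j).1|exact: ck].
have kbox j : bid 0 j <= k 0 j <= ask 0 j.
  by have := (cal j).2; rewrite ck !lee_fin.
have [ip ep] := integral_payoff _ _ y muk.
have ic := finite_measure_integrable_cst mu (price bid ask y) measurableT.
have ih : mu.-integrable setT (EFin \o h).
  by exact: (integrableB measurableT ip ic).
have mh : measurable_fun setT (EFin \o h) by exact: measurable_int ih.
have h0 : (\int[mu]_w `|(EFin \o h) w| = 0)%E.
  apply/eqP; rewrite eq_le integral_ge0// andbT.
  under eq_integral do rewrite /= ger0_norm ?ypos// EFinB.
  rewrite integralB// ep integral_cst//.
  rewrite [X in (_ * X)%E](probability_setT mu) mule1 -EFinB lee_fin.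
  by rewrite subr_le0 dot_le_price.
have /(null_dominates_ae_eq measurableT dmu)[A [mA wA hA]] :=
  (ae_eq_integral_abs mu measurableT mh).1 h0.
have nAw : ~ A w.
  move=> Aw; move: wA; rewrite /= diracE mem_set// => /eqP.
  by rewrite eqe oner_eq0.
apply: contrapT => hw; apply/nAw/hA => /= /(_ I)[].
exact: hw.
Qed.

Lemma calibrated_of_no_arbitrage bid ask :
  (forall j, bid 0 j <= ask 0 j) -> no_arbitrage g bid ask ->
  forall nu : probability T R,
    exists2 mu : probability T R, calibrated g bid ask mu & nu `<< mu.
Proof.
move=> ba na nu.
have [|k [mu numu muk] kbox] := box_meets_convex (attainable nu) bid ask ba
    (convex_attainable nu) (attainable_nonempty nu).
  move=> y sy k [mu numu muk].
  have payE w : payoff g y w = price bid ask y.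
    apply/eqP; rewrite -subr_eq0 (na y) // => v.
    exact: superreplicates_pointwise sy.
  have [_] := integral_payoff _ _ y muk.
  under eq_integral do rewrite payE.
  by rewrite integral_cst// [X in (_ * X)%E](probability_setT mu) mule1 => -[].
exists mu => // j; have [gi ge] := muk j; split => //.
by rewrite ge !lee_fin.
Qed.

End ftap.

Theorem theorem2p1 (R : realType) (Omega : ptopologicalType)
    (Omega_polish : polish R Omega)
    (m : nat) (g : 'I_m -> borel Omega -> R)
    (g_measurable : forall j : 'I_m, measurable_fun [set: borel Omega] (g j))
    (bid ask : 'rV[R]_m)
    (bid_le_ask : forall j : 'I_m, bid 0 j <= ask 0 j) :
  no_arbitrage g bid ask <->
  (forall nu : probability (borel Omega) R,
    exists2 mu : probability (borel Omega) R,
      calibrated g bid ask mu & nu `<< mu).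
Proof.
by split; [exact: calibrated_of_no_arbitrage|exact: no_arbitrage_of_calibrated].
Qed.
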